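(* Fix integers $1\le t<k$ and $\lambda\ge 1$. Let $\mathcal{C}\subseteq\binom{[n]}{k}$ be a random family in which each $k$-subset of $[n]$ is included independently with probability $p=p(n)$. Let $X=X_\lambda$ denote the number of $t$-subsets of $[n]$ that are contained in at least $\lambda+1$ members of $\mathcal{C}$. Then, as $n\to\infty$, \[ p\ll \frac{1}{n^{(k-t)+t/(\lambda+1)}} \Rightarrow \mathbb{P}(X=0)\to 1, \] and \[ p\gg \frac{1}{n^{(k-t)+t/(\lambda+1)}} \Rightarrow \mathbb{P}(X=0)\to 0. \]
   Context: For nonnegative functions $f,g$, $f\ll g$ (equivalently $g\gg f$) means $f(n)=o(g(n))$ as $n\to\infty$. $\binom{[n]}{k}$ denotes the family of $k$-element subsets of $[n]=\{1,\dots,n\}$. *)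

(* Defs.v *)
From HB Require Import structures.
From mathcomp Require Import all_boot all_order all_algebra.
From mathcomp Require Import all_classical all_reals all_analysis.
Set Implicit Arguments. Unset Strict Implicit. Unset Printing Implicit Defensive.
Import Order.TTheory GRing.Theory Num.Theory numFieldNormedType.Exports.

(* The ground set [n] = {1, ..., n} is represented by 'I_n = {0, ..., n-1}. *)
Definition ksubsets (n k : nat) : {set {set 'I_n}} :=
  [set S : {set 'I_n} | #|S| == k]%SET.

Definition codegree (n : nat) (C : {set {set 'I_n}}) (T : {set 'I_n}) : nat :=
  #|[set B : {set 'I_n} in C | T \subset B]%SET|.

(* The random variable X_lambda, as a function of the outcome C. *)
Definition num_heavy (n t lam : nat) (C : {set {set 'I_n}}) : nat :=
  #|[set T : {set 'I_n} in ksubsets n t | (lam.+1 <= codegree C T)%N]%SET|.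

Section RandomFamily.
Local Open Scope ring_scope.
Variables (R : realType) (n k : nat) (p : R).

(* Law of the random family: the product, over all k-subsets S of [n], of
   Bernoulli(p) laws for the event that S is in C. *)
Definition family_mass (C : {set {set 'I_n}}) : R :=
  \prod_(S in ksubsets n k) (if S \in C then p else 1 - p).

(* The sample space consists of the families C included in ksubsets n k. *)
Definition family_prob (E : pred {set {set 'I_n}}) : R :=
  \sum_(C in powerset (ksubsets n k) | E C) family_mass C.

(* Total mass 1 is the case A = set0. Together with additivity, these values
   determine the law: membership events are independent of probability p. *)
Lemma family_prob_superset (A : {set {set 'I_n}}) : A \subset ksubsets n k ->
  family_prob [pred C : {set {set 'I_n}} | A \subset C] = p ^+ #|A|.
Proof.
move=> sAK; set K := ksubsets n k in sAK *.
pose F S : R := if S \in K then p else 0.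
pose G S : R := if S \in A then 0 else if S \in K then 1 - p else 1.
have -> : p ^+ #|A| = \prod_S (F S + G S).
  rewrite -prodr_const big_mkcond; apply: eq_bigr => S _; rewrite /F /G.
  have [/(fintype.subsetP sAK) -> | _] := boolP (S \in A); first by rewrite addr0.
  by case: (S \in K); rewrite ?add0r // addrC subrK.
rewrite bigA_distr /family_prob big_mkcond; apply: eq_bigr => C _ /=.
rewrite powersetE; case: ifPn => [/andP[sCK sAC] | ].
  rewrite /family_mass big_mkcond; apply: eq_bigr => S _; rewrite /F /G -/K.
  case: ifPn => [SK|SK].
    by case: ifPn => // SC; rewrite (contraNF (fintype.subsetP sAC S) SC).
  rewrite (contraNF (fintype.subsetP sCK S) SK).
  by rewrite (contraNF (fintype.subsetP sAK S) SK).
rewrite negb_and => /orP[] /subsetPn[S S1 S2]; rewrite (bigD1 S) //= /F /G.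
  by rewrite S1 (negbTE S2) mul0r.
by rewrite (negbTE S2) S1 mul0r.
Qed.

End RandomFamily.

(* Main.v *)
(* If p is below the threshold, a union bound over pairs (T, A), with A a set of
   lam + 1 of the k-sets containing T, bounds P(X > 0) by
   n^t (n^(k-t) p)^(lam+1), which tends to 0.

   Above the threshold no second moment is needed.  Fix disjoint blocks L, H_0,
   ..., H_lam of s = n / (lam + 2) points.  For a t-subset T of L, let F(T, j) be
   the family of the sets T :|: S with S a (k-t)-subset of H_j.  These families
   are pairwise disjoint, so the events that C meets F(T, j) are independent, and
   T is heavy as soon as C meets F(T, j) for all j.  Hence
     P(X = 0) <= (1 - (1 - (1 - p)^m)^(lam+1))^N, m = 'C(s, k - t), N = 'C(s, t),
   and the inequality (1 - x)^m <= 1 / (1 + m x), used twice, makes this tend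
   to 0. *)
Require Import Defs.
From HB Require Import structures.
From mathcomp Require Import all_boot all_order all_algebra.
From mathcomp Require Import all_classical all_reals all_analysis.
From mathcomp Require Import ring lra zify.
Set Implicit Arguments. Unset Strict Implicit. Unset Printing Implicit Defensive.
Import Order.TTheory GRing.Theory Num.Theory numFieldNormedType.Exports.
Local Open Scope ring_scope.

(** * Expectation over the random family, and independence across disjoint sets of k-sets *)

Section FamilyExpectation.
Variables (R : realType) (n k : nat) (p : R).
Local Notation family := {set {set 'I_n}}.
Local Notation K := (ksubsets n k).

Definition family_expect (f : family -> R) : R :=
  \sum_(C in powerset K) family_mass k p C * f C.

Lemma family_probE (E : pred family) :
  family_prob k p E = family_expect (fun C => (E C)%:R).
Proof.
rewrite /family_prob big_mkcondr; apply: eq_bigr => C _.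
by case: (E C); rewrite ?mulr1 ?mulr0.
Qed.

Lemma eq_family_expect (f g : family -> R) :
  f =1 g -> family_expect f = family_expect g.
Proof. by move=> fg; apply: eq_bigr => C _; rewrite fg. Qed.

Lemma family_expectB (f g : family -> R) :
  family_expect (fun C => f C - g C) = family_expect f - family_expect g.
Proof. by rewrite /family_expect -sumrB; apply: eq_bigr => C _; rewrite mulrBr. Qed.

Lemma family_expect_sum (I : finType) (P : pred I) (f : I -> family -> R) :
  family_expect (fun C => \sum_(i | P i) f i C) =
  \sum_(i | P i) family_expect (f i).
Proof.
by rewrite exchange_big /=; apply: eq_bigr => C _; rewrite mulr_sumr.
Qed.

Lemma family_expect1 : family_expect (fun=> 1) = 1.
Proof.
have := family_prob_superset p (finset.sub0set K).
rewrite cards0 expr0 family_probE => PE; rewrite -[RHS]PE.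
by apply: eq_family_expect => C; rewrite /= finset.sub0set.
Qed.

Hypothesis p01 : 0 <= p <= 1.

Lemma family_mass_ge0 (C : family) : 0 <= family_mass k p C.
Proof.
by case/andP: p01 => p0 p1; apply: prodr_ge0 => S _; case: ifP; rewrite ?subr_ge0.
Qed.

Lemma le_family_expect (f g : family -> R) :
  (forall C : family, C \subset K -> f C <= g C) -> family_expect f <= family_expect g.
Proof.
move=> fg; apply: ler_sum => C; rewrite powersetE => CK.
by rewrite ler_wpM2l ?family_mass_ge0 ?fg.
Qed.

Definition depends_on (U : family) (f : family -> R) :=
  forall C D : family, C :&: U = D :&: U -> f C = f D.

(* Phrased against arbitrary functions f of the part of C outside U, so that it
   is stable under complement and under products over disjoint U. *)
Definition indep_factor (U : family) (h : family -> R) (c : R) :=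
  depends_on U h /\
  forall f, depends_on (~: U)%SET f ->
    family_expect (fun C => f C * h C) = c * family_expect f.

Lemma depends_onS (U V : family) f : U \subset V -> depends_on U f -> depends_on V f.
Proof.
move=> UV fU C D CD; apply: fU.
by rewrite -(finset.setIidPr UV) !finset.setIA CD.
Qed.

Lemma depends_onM (U : family) f g :
  depends_on U f -> depends_on U g -> depends_on U (fun C => f C * g C).
Proof. by move=> fU gU C D CD; rewrite (fU _ _ CD) (gU _ _ CD). Qed.

Lemma indep_factor_compl U h c :
  indep_factor U h c -> indep_factor U (fun C => 1 - h C) (1 - c).
Proof.
move=> [hU hE]; split=> [C D CD|f fU]; first by rewrite (hU _ _ CD).
rewrite (_ : family_expect _ = family_expect (fun C => f C - f C * h C)).
  by rewrite family_expectB hE // mulrBl mul1r.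
by apply: eq_family_expect => C; rewrite mulrBr mulr1.
Qed.

(** The factors are pulled out one at a time. As [U] and [V] are disjoint, [f * g] does not look at
    [V], so [h] comes out first; what remains, [f], does not look at [U], so [g] comes out next. *)
Lemma indep_factorM (U V : family) g h c d : [disjoint U & V] ->
  indep_factor U g c -> indep_factor V h d ->
  indep_factor (U :|: V) (fun C => g C * h C) (c * d).
Proof.
move=> UV [gU gE] [hV hE]; split=> [|f fUV].
  by apply: depends_onM; [apply: depends_onS gU|apply: depends_onS hV];
    rewrite ?finset.subsetUl ?finset.subsetUr.
rewrite (_ : family_expect _ = family_expect (fun C => f C * g C * h C)); last first.
  by apply: eq_family_expect => C; rewrite mulrA.
rewrite hE; last first.
  apply: depends_onM; last by apply: depends_onS gU; rewrite finset.subsets_disjoint finset.setCK.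
  by apply: depends_onS fUV; rewrite finset.setCS finset.subsetUr.
rewrite gE; last by apply: depends_onS fUV; rewrite finset.setCS finset.subsetUl.
by rewrite mulrCA mulrA.
Qed.

Lemma indep_factor_prod (I : finType) (A : {set I})
    (U : I -> family) (h : I -> family -> R) (c : I -> R) :
  {in A &, forall i j, i != j -> [disjoint U i & U j]} ->
  {in A, forall i, indep_factor (U i) (h i) (c i)} ->
  indep_factor (\bigcup_(i in A) U i)%SET (fun C => \prod_(i in A) h i C)
    (\prod_(i in A) c i).
Proof.
move: {2}(#|A|) (erefl #|A|) => m; elim: m A => [|m IH] A.
  move/eqP; rewrite cards_eq0 => /eqP -> _ _; rewrite !big_set0.
  split=> [C D _|f _]; rewrite ?big_set0 //.
  by rewrite mul1r; apply: eq_family_expect => C; rewrite big_set0 mulr1.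
move=> Am; have /card_gt0P[i iA] : (0 < #|A|)%N by rewrite Am.
move=> dis ind; rewrite 2!(finset.big_setD1 i iA) /=.
rewrite (_ : (fun C => _) = fun C => h i C * \prod_(j in (A :\ i)%SET) h j C); last first.
  by apply/funext => C; rewrite (finset.big_setD1 i iA).
have sA : {subset (A :\ i)%SET <= A} by move=> j /finset.setD1P[].
apply: indep_factorM; [|exact: ind|].
  apply: finset.bigcup_disjoint => j /finset.setD1P[ji jA].
  by apply: dis; rewrite // eq_sym.
apply: IH => [|j l /sA jA /sA lA|j /sA]; [|exact: dis|exact: ind].
by move: Am; rewrite (cardsD1 i) iA add1n => -[].
Qed.

(** Pair each family [C] without [S] with [S |: C]. On such a pair [f] takes one value and the
    masses are [1 - p] and [p] times the common product [m' C], so the pair weighs [m' C] in all;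
    keeping only the member without [S] retains the fraction [1 - p]. *)
Lemma indep_factor_notin (S : {set 'I_n}) : S \in K ->
  indep_factor [set S]%SET (fun C => (S \notin C)%:R) (1 - p).
Proof.
move=> SK; split=> [C D /finset.setP/(_ S)|f fS].
  by rewrite !inE eqxx !andbT => ->.
pose m' (C : family) := \prod_(B in (K :\ S)%SET) (if B \in C then p else 1 - p).
have massE C : family_mass k p C = (if S \in C then p else 1 - p) * m' C.
  by rewrite /family_mass (finset.big_setD1 S).
rewrite /family_expect mulr_sumr.
rewrite [LHS](bigID (fun C : family => S \in C)) [RHS](bigID (fun C : family => S \in C)) /=.
rewrite big1 ?add0r; last by move=> C /andP[_ ->]; rewrite /= !mulr0.
rewrite [X in _ = X + _](reindex_onto (fun D => S |: D)%SET (fun D => D :\ S)%SET) /=; last first.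
  by move=> C /andP[_ SC]; rewrite finset.setD1K.
rewrite [X in _ = X + _](eq_bigl (fun C : family => (C \in powerset K) && (S \notin C))); last first.
  move=> C; rewrite !powersetE !inE eqxx finset.subUset finset.sub1set SK /= andbT.
  by congr (_ && _); apply/eqP/idP => [<-|/finset.setU1K //]; rewrite !inE eqxx.
rewrite -big_split; apply: eq_bigr => C /andP[_ SC] /=.
rewrite !massE (negbTE SC) !inE eqxx /=.
have -> : m' (S |: C)%SET = m' C.
  by apply: eq_bigr => B /finset.setD1P[BS _]; rewrite !inE (negbTE BS).
have -> : f (S |: C)%SET = f C.
  apply: fS; apply/finset.setP => B; rewrite !inE.
  by case: (B == S); rewrite /= ?andbF.
by rewrite mulr1; ring.
Qed.

(** Avoiding [U] is the product, over [S] in [U], of the indicators of [S \notin C], which live on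
    disjoint singletons. *)
Lemma indep_factor_avoid (U : family) : U \subset K ->
  indep_factor U (fun C => [disjoint U & C]%:R) ((1 - p) ^+ #|U|).
Proof.
move=> UK.
have := @indep_factor_prod _ U (fun S => [set S]%SET)
  (fun S C => (S \notin C)%:R) (fun=> 1 - p).
rewrite prodr_const (_ : (\bigcup_(i in U) _)%SET = U); last first.
  apply/finset.setP => S; apply/finset.bigcupP/idP => [[B BU /set1P -> //]|SU].
  by exists S; rewrite ?inE.
rewrite (_ : (fun C : family => \prod_(S in U) (S \notin C)%:R) =
  fun C => [disjoint U & C]%:R); last first.
  apply/funext => C; case: (boolP [disjoint U & C]) => [UC|].
    by apply: big1 => S SU; rewrite (disjointFr UC).
  rewrite -finset.setI_eq0 => /set0Pn[S /finset.setIP[SU SC]].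
  by rewrite (bigD1 S) //= SC mul0r.
apply=> [S B _ _ SB|S SU]; last by apply: indep_factor_notin; apply: (fintype.subsetP UK).
by rewrite disjoints1 inE.
Qed.

(** This is the defining identity at the constant [f = 1]. *)
Lemma indep_factor_expect U h c : indep_factor U h c -> family_expect h = c.
Proof.
case=> _ /(_ (fun=> 1)) /(_ (fun _ _ _ => erefl)).
rewrite family_expect1 mulr1 => <-.
by apply: eq_family_expect => C; rewrite mul1r.
Qed.

End FamilyExpectation.

(** * Counting bounds and the union bound below the threshold *)

Lemma leq_bin_exp (m r : nat) : ('C(m, r) <= m ^ r)%N.
Proof.
apply: (@leq_trans ('C(m, r) * r`!)); first by rewrite leq_pmulr ?fact_gt0.
rewrite bin_ffact ffact_prod -[X in (_ <= _ ^ X)%N]card_ord -prod_nat_const.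
by apply: leq_prod => i _; rewrite leq_subr.
Qed.

(** Removing [T] is injective on the supersets of [T] and lands in the sets of size [k - #|T|]. *)
Lemma card_ksupersets_le (n k : nat) (T : {set 'I_n}) :
  (#|[set B in ksubsets n k | T \subset B]%SET| <= n ^ (k - #|T|))%N.
Proof.
have inj : {in [set B in ksubsets n k | T \subset B]%SET &,
    injective (fun B => B :\: T)%SET}.
  move=> B B'; rewrite !inE => /andP[_ TB] /andP[_ TB'] BB'.
  by rewrite -(finset.setID B T) -(finset.setID B' T) BB' !(finset.setIidPr _).
rewrite -(card_in_imset inj).
apply: leq_trans (leq_bin_exp n (k - #|T|)).
rewrite -[X in 'C(X, _)]card_ord -card_draws; apply: subset_leq_card.
apply/fintype.subsetP => S /imsetP[B]; rewrite !inE => /andP[/eqP Bk TB] ->.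
by rewrite cardsDS // Bk.
Qed.

Lemma exists_subset_card (T : finType) (A : {set T}) (m : nat) :
  (m <= #|A|)%N -> exists2 B : {set T}, B \subset A & #|B| = m.
Proof.
rewrite -bin_gt0 -cards_draws card_gt0 => /set0Pn[B].
by rewrite inE => /andP[BA /eqP Bm]; exists B.
Qed.

Lemma family_prob_num_heavy0_ge (R : realType) (n t k lam : nat) (p : R) :
  0 <= p <= 1 ->
  1 - family_prob k p [pred C : {set {set 'I_n}} | num_heavy t lam C == 0%N] <=
  (n%:R ^+ t * n%:R ^+ (k - t) ^+ lam.+1) * p ^+ lam.+1.
Proof.
move=> p01; have /andP[p0 _] := p01.
pose D (T : {set 'I_n}) := [set B in ksubsets n k | T \subset B]%SET.
pose draws T := [set A : {set {set 'I_n}} | A \subset D T & #|A| == lam.+1]%SET.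
rewrite family_probE -[X in X - _](family_expect1 n k p) -family_expectB.
apply: (@le_trans _ _ (family_expect k p (fun C =>
  \sum_(T in ksubsets n t) \sum_(A in draws T) (A \subset C)%:R))).
  apply: le_family_expect => // C CK /=.
  have [_|] := eqVneq (num_heavy t lam C) 0%N.
    by rewrite mulr1n subrr; apply: sumr_ge0 => T _; apply: sumr_ge0 => A _.
  rewrite cards_eq0 => /set0Pn[T]; rewrite inE => /andP[Tt].
  move=> /exists_subset_card[A AC Aq]; rewrite subr0.
  (* One heavy [T] with one such [A] already contributes 1 to the double sum; all other terms are
     nonnegative. *)
  rewrite (bigD1 T) //= (bigD1 A) /=; last first.
    rewrite inE Aq eqxx andbT; apply: fintype.subset_trans AC _.
    apply/fintype.subsetP => B; rewrite !inE => /andP[BC ->].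
    by have := fintype.subsetP CK B BC; rewrite inE => ->.
  rewrite (fintype.subset_trans AC) ?lerDl; last first.
    by apply/fintype.subsetP => B; rewrite !inE => /andP[].
  by rewrite -addrA lerDl addr_ge0 // ?sumr_ge0 // => T' _; rewrite sumr_ge0.
rewrite family_expect_sum.
apply: (@le_trans _ _ (\sum_(T in ksubsets n t)
  n%:R ^+ (k - t) ^+ lam.+1 * p ^+ lam.+1)); last first.
  rewrite sumr_const -[leLHS]mulr_natl -mulrA ler_wpM2r ?mulr_ge0 ?exprn_ge0 //.
  by rewrite card_draws card_ord -natrX ler_nat leq_bin_exp.
apply: ler_sum => T; rewrite inE => /eqP Tt; rewrite family_expect_sum.
rewrite (eq_bigr (fun=> p ^+ lam.+1)); last first.
  move=> A; rewrite inE => /andP[AD /eqP <-].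
  rewrite -(@family_prob_superset _ n k) ?family_probE //.
  apply: fintype.subset_trans AD _; apply/fintype.subsetP => B.
  by rewrite inE => /andP[].
rewrite sumr_const -[leLHS]mulr_natl ler_wpM2r ?exprn_ge0 // -!natrX ler_nat.
rewrite cards_draws; apply: leq_trans (leq_bin_exp _ _) _.
by rewrite leq_exp2r // -Tt card_ksupersets_le.
Qed.

(** * Disjoint blocks and the independent pieces above the threshold *)

Lemma card_ord_range (n a b : nat) : (b <= n)%N ->
  #|[set i : 'I_n | (a <= i < b)%N]%SET| = (b - a)%N.
Proof.
move=> bn; rewrite -sum1dep_card -(big_mkord (fun i => a <= i < b)%N (fun=> 1%N)).
under eq_bigl do rewrite andbC.
rewrite -(@big_nat_widenl _ _ _ a 0 n (fun i => i < b)%N) //.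
rewrite -(@big_nat_widen _ _ _ a b n xpredT) //.
by rewrite sum_nat_const_nat muln1.
Qed.

Section IndependentPieces.
Variables (R : realType) (n t k lam s : nat) (p : R).
Hypotheses (tk : (t < k)%N) (p01 : 0 <= p <= 1).
Variables (L : {set 'I_n}) (H : 'I_lam.+1 -> {set 'I_n}).
Hypotheses (cardL : #|L| = s) (cardH : forall j, #|H j| = s).
Hypothesis LH : forall j, [disjoint L & H j]%B.
Hypothesis HH : forall i j, i != j -> [disjoint H i & H j]%B.

Let draws (A : {set 'I_n}) (r : nat) := [set S : {set 'I_n} | S \subset A & #|S| == r]%SET.

(** This is the family F(T, j) of the opening comment. *)
Definition piece (T : {set 'I_n}) (j : 'I_lam.+1) : {set {set 'I_n}} :=
  [set T :|: S | S in draws (H j) (k - t)]%SET.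

Lemma pieceP T j B : T \in draws L t -> B \in piece T j ->
  [/\ (B :&: L = T)%SET, #|B :\: L|%SET = (k - t)%N, (B :\: L \subset H j)%SET & #|B| = k].
Proof.
rewrite inE => /andP[TL /eqP Tt] /imsetP[S]; rewrite inE => /andP[SH /eqP Sr] ->.
have SL0 : (S :&: L = finset.set0)%SET.
  apply/eqP; rewrite finset.setI_eq0 disjoint_sym.
  by apply: disjointWr SH _.
have TS0 : (T :&: S = finset.set0)%SET.
  apply/eqP; rewrite -finset.subset0 -SL0 finset.setIC.
  by rewrite finset.setIS.
have BD : ((T :|: S) :\: L = S)%SET.
  rewrite finset.setDUl (_ : T :\: L = finset.set0)%SET ?finset.set0U.
    by apply/finset.setDidPl; rewrite -finset.setI_eq0 SL0.
  by apply/eqP; rewrite finset.setD_eq0.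
split; rewrite ?BD //.
  by rewrite finset.setIUl SL0 finset.setU0; apply/finset.setIidPl.
by rewrite cardsU TS0 cards0 subn0 Tt Sr subnKC // ltnW.
Qed.

Lemma card_piece T j : T \in draws L t -> #|piece T j| = 'C(s, k - t).
Proof.
move=> TL; rewrite card_in_imset ?cards_draws ?cardH //.
move=> S S' SH SH' SS'.
have sub A : A \in draws (H j) (k - t) -> ((T :|: A) :\: T = A)%SET.
  rewrite inE => /andP[AH _]; rewrite finset.setDUl finset.setDv finset.set0U.
  apply/finset.setDidPl; rewrite disjoint_sym.
  apply: disjointWl (disjointWr AH (LH j)).
  by move: TL; rewrite inE => /andP[].
by rewrite -(sub _ SH) SS' sub.
Qed.

(** A common member [B] determines both indices: [T] is [B :&: L], and [B :\: L] is nonempty since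
    [t < k], so it cannot lie in two disjoint blocks. *)
Lemma disjoint_piece T T' j j' : T \in draws L t -> T' \in draws L t ->
  (T, j) != (T', j') -> [disjoint piece T j & piece T' j']%B.
Proof.
move=> TL TL'; apply: contraR; rewrite -finset.setI_eq0 => /set0Pn[B /finset.setIP[]].
move=> /(pieceP TL)[BT Bk Bj _] /(pieceP TL')[BT' _ Bj' _].
rewrite -BT -BT' xpair_eqE eqxx /=; apply/idPn => /HH.
apply/negP; rewrite -finset.setI_eq0; apply/set0Pn.
have /card_gt0P[x xB] : (0 < #|B :\: L|%SET)%N by rewrite Bk subn_gt0.
by exists x; rewrite finset.inE (fintype.subsetP Bj) // (fintype.subsetP Bj').
Qed.

(** Choose one member of [C] in each piece of [T]; the pieces are disjoint, so these are [lam.+1]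
    distinct supersets of [T]. *)
Lemma codegree_pieces (C : {set {set 'I_n}}) T : T \in draws L t ->
  (forall j, ~~ [disjoint piece T j & C]%B) -> (lam.+1 <= codegree C T)%N.
Proof.
move=> TL meet.
have {}meet j : exists B, (B \in piece T j) && (B \in C).
  by have := meet j; rewrite -finset.setI_eq0 => /set0Pn[B]; rewrite inE; exists B.
pose f j := xchoose (meet j).
have fP j : (f j \in piece T j) && (f j \in C) := xchooseP (meet j).
have finj : injective f.
  move=> i j fij; apply/eqP/idPn => ij.
  have dij : [disjoint piece T i & piece T j]%B.
    by apply: disjoint_piece; rewrite // xpair_eqE eqxx.
  have /andP[fi _] := fP i; have /andP[fj _] := fP j.
  by have := disjointFr dij fi; rewrite fij fj.
rewrite -[lam.+1]card_ord -(card_imset _ finj); apply: subset_leq_card.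
apply/fintype.subsetP => B /imsetP[j _ ->]; have /andP[fT fC] := fP j.
rewrite inE fC /=; have [<- _ _ _] := pieceP TL fT.
exact: finset.subsetIl.
Qed.

Lemma family_prob_pieces :
  family_prob k p [pred C : {set {set 'I_n}} | num_heavy t lam C == 0%N] <=
  (1 - (1 - (1 - p) ^+ 'C(s, k - t)) ^+ lam.+1) ^+ 'C(s, t).
Proof.
pose m := 'C(s, k - t).
(* [h T] is the indicator that [C] misses some piece of [T]. If no [T] is heavy, then every [h T]
   equals 1, so their product dominates the indicator of X = 0. *)
pose h T (C : {set {set 'I_n}}) : R :=
  1 - \prod_(j in [set: 'I_lam.+1]%SET) (1 - [disjoint piece T j & C]%B%:R).
pose c := 1 - \prod_(j in [set: 'I_lam.+1]%SET) (1 - (1 - p) ^+ m).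
have hc T : T \in draws L t ->
    indep_factor k p (\bigcup_(j in [set: 'I_lam.+1]) piece T j)%SET (h T) c.
  move=> TL; apply: indep_factor_compl; apply: indep_factor_prod => [i j _ _ ij|j _].
    by apply: disjoint_piece; rewrite // xpair_eqE eqxx.
  apply: indep_factor_compl; rewrite /m -(card_piece j TL); apply: indep_factor_avoid.
  apply/fintype.subsetP => B BT; rewrite inE.
  by have [_ _ _ ->] := pieceP TL BT.
have Eh : family_expect k p (fun C => \prod_(T in draws L t) h T C) = c ^+ 'C(s, t).
  rewrite -cardL -cards_draws -prodr_const.
  apply: (@indep_factor_expect _ _ _ _ (\bigcup_(T in draws L t) \bigcup_(j in [set: 'I_lam.+1]) piece T j)%SET).
  apply: indep_factor_prod hc => T T' TL TL' TT'.
  apply: finset.bigcup_disjoint => j _; rewrite disjoint_sym.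
  apply: finset.bigcup_disjoint => i _.
  by apply: disjoint_piece; rewrite // xpair_eqE negb_and eq_sym TT'.
move: Eh; rewrite /c prodr_const cardsT card_ord => <-.
rewrite family_probE; apply: le_family_expect => // C _ /=.
have [X0|_] := eqVneq (num_heavy t lam C) 0%N; last first.
  apply: prodr_ge0 => T _; rewrite subr_ge0; apply: prodr_ile1 => j _.
  by case: [disjoint _ & _]%B; rewrite ?subrr ?subr0 ?lexx ler01.
rewrite big1 // => T TL; rewrite /h.
have [meet|] := boolP [forall j, ~~ [disjoint piece T j & C]%B].
  have : T \in finset.set0.
    move/eqP: X0; rewrite cards_eq0 => /eqP <-; rewrite inE.
    rewrite codegree_pieces ?andbT //; last exact/forallP.
    by move: TL; rewrite inE => /andP[_]; rewrite inE.
  by rewrite inE.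
rewrite negb_forall => /existsP[j]; rewrite negbK => TC.
by rewrite (bigD1 j) ?inE //= TC subrr mul0r subr0.
Qed.
End IndependentPieces.

Lemma family_prob_num_heavy0_le (R : realType) (n t k lam s : nat) (p : R) :
  (t < k)%N -> 0 <= p <= 1 -> (lam.+2 * s <= n)%N ->
  family_prob k p [pred C : {set {set 'I_n}} | num_heavy t lam C == 0%N] <=
  (1 - (1 - (1 - p) ^+ 'C(s, k - t)) ^+ lam.+1) ^+ 'C(s, t).
Proof.
move=> tk p01 sn.
(* Consecutive intervals of length [s]: block 0 serves as L and block j + 1 as H_j. *)
pose block a := [set i : 'I_n | (a * s <= i < a.+1 * s)%N]%SET.
have cardb a : (a < lam.+2)%N -> #|block a| = s.
  move=> al; rewrite card_ord_range -?mulnBl ?subSnn ?mul1n //.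
  by apply: leq_trans sn; rewrite leq_mul2r al orbT.
have disb a b : a != b -> [disjoint block a & block b]%B.
  move=> ab; rewrite -finset.setI_eq0; apply/eqP/finset.setP => i.
  by rewrite !inE; apply/negP; nia.
apply: (@family_prob_pieces _ _ _ _ _ _ _ tk p01 (block 0%N) (fun j => block j.+1)).
- exact: cardb.
- by move=> j; apply: cardb; rewrite ltnS.
- by move=> j; apply: disb.
- by move=> i j ij; apply: disb.
Qed.

(** * Estimates for binomials, powers and the threshold *)

Lemma leq_exp_bin (l r n : nat) : (0 < l)%N -> (l * (4 * r).+1 <= n)%N ->
  (n ^ r <= r`! * (4 * l) ^ r * 'C(n %/ l, r))%N.
Proof.
move=> l0 ln; set s := (n %/ l)%N.
have sr : ((4 * r).+1 <= s)%N by rewrite leq_divRL // mulnC.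
(* Here [n < s.+1 * l], and [4 * r < s] gives [s + 1 <= 4 * (s - r)]. The bound then follows because
   each of the [r] factors of the falling factorial of [s] is at least [s - r]. *)
have ns : (n <= 4 * l * (s - r))%N.
  have : (n < s.+1 * l)%N by rewrite -ltn_divLR.
  by move: sr; nia.
apply: (@leq_trans ((4 * l * (s - r)) ^ r)).
  by case: r ln sr ns => // r _ _ ns; rewrite leq_exp2r.
rewrite expnMn [leqRHS]mulnAC [leqRHS]mulnC leq_mul2l; apply/orP; right.
rewrite mulnC bin_ffact ffact_prod -[X in (_ ^ X <= _)%N]card_ord -prod_nat_const.
by apply: leq_prod => i _; rewrite leq_sub2l // ltnW.
Qed.

Section RealEstimates.
Variable R : realType.

(** Induction on [m], from [(1 - x) * (1 + (m + 1) * x) <= 1 + m * x]. *)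
Lemma exp_onem_le (x : R) (m : nat) : 0 <= x <= 1 ->
  (1 - x) ^+ m <= (1 + m%:R * x)^-1.
Proof.
move=> /andP[x0 x1]; have pos i : 0 < 1 + i%:R * x.
  by rewrite ltr_pwDl ?mulr_ge0 ?ltr01.
rewrite -[leRHS]mul1r ler_pdivlMr //.
elim: m => [|m IH]; first by rewrite expr0 mul0r addr0 mul1r.
apply: le_trans IH; rewrite exprSr -mulrA ler_wpM2l ?exprn_ge0 ?subr_ge0 //.
have m0 : 0 <= m%:R :> R by [].
by rewrite -natr1; nra.
Qed.

(** [exp_onem_le] with exponent [m] bounds the inner base below by [u / (1 + u)]; with exponent [N]
    it then gives the claim. A free lower bound [u] in place of [m * p] allows [u] to be chosen at
    most 1 later. *)
Lemma pieces_bound_le (p u : R) (m N q : nat) : 0 <= p <= 1 -> 0 <= u <= m%:R * p ->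
  (1 - (1 - (1 - p) ^+ m) ^+ q) ^+ N <= (1 + N%:R * (u / (1 + u)) ^+ q)^-1.
Proof.
move=> p01 /andP[u0 ump]; have /andP[p0 p1] := p01.
have x01 : 0 <= 1 - (1 - p) ^+ m <= 1.
  by rewrite subr_ge0 gerBl exprn_ge0 ?exprn_ile1 ?subr_ge0 // gerBl.
have ux : u / (1 + u) <= 1 - (1 - p) ^+ m.
  rewrite (_ : u / (1 + u) = 1 - (1 + u)^-1); last by field; lra.
  rewrite lerB // (le_trans (exp_onem_le m p01)) // lef_pV2 ?posrE; lra.
have uu0 : 0 <= u / (1 + u) by rewrite divr_ge0; lra.
have /andP[x0 x1] := x01.
have X01 : 0 <= (1 - (1 - p) ^+ m) ^+ q <= 1 by rewrite exprn_ge0 ?exprn_ile1.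
have Y0 : 0 <= (u / (1 + u)) ^+ q by rewrite exprn_ge0.
have XY : (u / (1 + u)) ^+ q <= (1 - (1 - p) ^+ m) ^+ q.
  by rewrite lerXn2r ?nnegrE.
apply: le_trans (exp_onem_le N X01) _.
have XYN : N%:R * (u / (1 + u)) ^+ q <= N%:R * (1 - (1 - p) ^+ m) ^+ q by rewrite ler_wpM2l.
have NY0 : 0 <= N%:R * (u / (1 + u)) ^+ q by rewrite mulr_ge0.
by rewrite lef_pV2 ?posrE; lra.
Qed.

Lemma threshold_gt0 (n : nat) (e : R) : (0 < n)%N -> 0 < 1 / (n%:R `^ e).
Proof. by move=> n0; rewrite divr_gt0 ?powR_gt0 ?ltr0n ?ltr01. Qed.

(** The union bound [n^t * (n^(k-t) * p)^(lam+1)] equals exactly 1 at the threshold, since the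
    exponent times [lam + 1] is [(k - t) * (lam + 1) + t]. *)
Lemma threshold_pow (n t k lam : nat) : (0 < n)%N -> (t <= k)%N ->
  (n%:R ^+ (k - t) * (1 / (n%:R `^ ((k%:R - t%:R) + t%:R / (lam%:R + 1))))) ^+ lam.+1
    * n%:R ^+ t = 1 :> R.
Proof.
move=> n0 tk; set e := (_ + _ : R).
have n0' : 0 < n%:R :> R by rewrite ltr0n.
have l0 : lam%:R + 1 != 0 :> R by rewrite natr1 pnatr_eq0.
have -> : 1 / n%:R `^ e = (n%:R `^ e)^-1 by rewrite div1r.
have E : (n%:R `^ e) ^+ lam.+1 = n%:R ^+ (k - t) ^+ lam.+1 * n%:R ^+ t.
  rewrite -powR_mulrn ?powR_ge0 // -powRrM -exprM -exprD -powR_mulrn ?ltW //.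
  by congr (_ `^ _); rewrite /e natrD natrM natrB // -natr1; field.
rewrite exprMn exprVn E; field.
by rewrite !expf_neq0 ?lt0r_neq0.
Qed.

End RealEstimates.

(** * The two limits *)

Local Open Scope classical_set_scope.

Theorem theorem2p3 (R : realType) (t k lam : nat)
    (ht : (1 <= t)%N) (htk : (t < k)%N) (hlam : (1 <= lam)%N)
    (p : nat -> R) (hp : forall n : nat, 0 <= p n <= 1) :
  let threshold : nat -> R := fun n : nat =>
    1 / (n%:R `^ ((k%:R - t%:R) + t%:R / (lam%:R + 1))) in
  let PX0 : nat -> R := fun n : nat =>
    family_prob k (p n) [pred C : {set {set 'I_n}} | num_heavy t lam C == 0%N] in
  (p =o_\oo threshold -> PX0 n @[n --> \oo] --> (1 : R)) /\
  (threshold =o_\oo p -> PX0 n @[n --> \oo] --> (0 : R)).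
Proof.
move=> threshold PX0.
have PX0_ge0 n : 0 <= PX0 n.
  by apply: sumr_ge0 => C _; apply: family_mass_ge0.
have PX0_le1 n : PX0 n <= 1.
  rewrite /PX0 family_probE -[leRHS](family_expect1 n k (p n)).
  by apply: le_family_expect => // C _ /=; case: eqP; rewrite ?ler01 ?lexx.
split=> [/eqoP po|/eqoP tho]; apply/cvgrPdist_le => /= e e0.
  (* Capping at 1 gives [d ^+ lam.+1 <= d <= e]. *)
  pose d := Num.min e 1.
  have d0 : 0 < d by rewrite lt_min e0 ltr01.
  have /andP[de d1] : (d <= e) && (d <= 1) by rewrite !ge_min !lexx orbT.
  near=> n.
  have n0 : (0 < n)%N by near: n; exact: nbhs_infty_gt.
  have pn : `|p n| <= d * `|threshold n| by near: n; exact: po.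
  have /andP[pn0 pn1] := hp n.
  have th0 : 0 < threshold n := threshold_gt0 _ n0.
  rewrite (ger0_norm pn0) (gtr0_norm th0) in pn.
  rewrite ger0_norm ?subr_ge0 //; apply: le_trans de.
  apply: (le_trans (family_prob_num_heavy0_ge n t k lam (hp n))).
  have n0' : 0 <= n%:R :> R by [].
  apply: (@le_trans _ _ (n%:R ^+ t * n%:R ^+ (k - t) ^+ lam.+1 * (d * threshold n) ^+ lam.+1)).
    by rewrite ler_wpM2l ?mulr_ge0 ?exprn_ge0 // lerXn2r ?nnegrE ?mulr_ge0 ?(ltW d0) ?(ltW th0).
  have := threshold_pow R lam n0 (ltnW htk); rewrite -/(threshold n) exprMn => E.
  rewrite exprMn (_ : _ * _ = d ^+ lam.+1 *
    (n%:R ^+ (k - t) ^+ lam.+1 * threshold n ^+ lam.+1 * n%:R ^+ t)); last by ring.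
  by rewrite E mulr1 exprS ler_piMr ?exprn_ile1 // ltW.
(* The constant of [leq_exp_bin] for [l = lam.+2], so that [n^r <= D r * 'C(s, r)] for large [n]. *)
pose D r : R := (r`! * (4 * lam.+2) ^ r)%N%:R.
have D0 r : 0 < D r by rewrite ltr0n muln_gt0 fact_gt0 expn_gt0.
(* p >= w D(k-t) threshold gives m p >= w v with v^(lam+1) = n^(-t); once
   w v <= 1, this yields N (w v / (1 + w v))^(lam+1) >= (w / 2)^(lam+1) / D(t). *)
pose w := 2 * (D t / e) + 2.
have De0 : 0 < D t / e by rewrite divr_gt0.
have w2 : 2 <= w by rewrite /w; lra.
have w0 : 0 < w by lra.
near=> n.
have n0 : (0 < n)%N by near: n; exact: nbhs_infty_gt.
have nt : (lam.+2 * (4 * t).+1 <= n)%N by near: n; exact: nbhs_infty_ge.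
have nk : (lam.+2 * (4 * (k - t)).+1 <= n)%N by near: n; exact: nbhs_infty_ge.
have nw : w ^+ lam.+1 <= n%:R by near: n; exact: nbhs_infty_ger.
have thn : `|threshold n| <= (w * D (k - t)%N)^-1 * `|p n|.
  by near: n; apply: tho; rewrite invr_gt0 mulr_gt0.
have /andP[pn0 pn1] := hp n.
have th0 : 0 < threshold n := threshold_gt0 _ n0.
rewrite (ger0_norm pn0) (gtr0_norm th0) mulrC ler_pdivlMr ?mulr_gt0 // in thn.
rewrite sub0r normrN ger0_norm //.
pose s := (n %/ lam.+2)%N.
have sn : (lam.+2 * s <= n)%N by rewrite mulnC leq_divM.
apply: le_trans (family_prob_num_heavy0_le htk (hp n) sn) _.
have binD r : (lam.+2 * (4 * r).+1 <= n)%N -> n%:R ^+ r <= D r * 'C(s, r)%:R.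
  by move=> nr; rewrite -natrX -natrM ler_nat leq_exp_bin.
have n0' : 0 < n%:R :> R by rewrite ltr0n.
pose v := n%:R ^+ (k - t) * threshold n.
have v0 : 0 < v by rewrite mulr_gt0 ?exprn_gt0.
have vt : v ^+ lam.+1 * n%:R ^+ t = 1 by apply: threshold_pow => //; exact: ltnW.
have wv : 0 <= w * v <= 'C(s, k - t)%:R * p n.
  rewrite (ltW (mulr_gt0 w0 v0)) /=.
  apply: (@le_trans _ _ ('C(s, k - t)%:R * (threshold n * (w * D (k - t)%N)))).
    rewrite /v (_ : _ * (threshold n * _) = w * (D (k - t)%N * 'C(s, k - t)%:R * threshold n)); last by ring.
    by rewrite ler_pM2l // ler_pM2r // binD.
  by rewrite ler_wpM2l.
apply: le_trans (pieces_bound_le _ _ (hp n) wv) _.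
(* As [t >= 1], [w ^+ lam.+1 <= n <= n^t], while [v ^+ lam.+1] is the inverse of [n^t]. *)
have wv1 : w * v <= 1.
  rewrite -(@expr_le1 _ lam.+1) ?(ltW (mulr_gt0 w0 v0)) //.
  rewrite exprMn -vt mulrC ler_wpM2l ?exprn_ge0 ?(ltW v0) //.
  apply: le_trans nw _; rewrite -[leLHS]expr1; apply: ler_weXn2l => //.
  by rewrite ler1n.
have wv0 : 0 < w * v by rewrite mulr_gt0.
have half : w * v / 2 <= w * v / (1 + w * v).
  by rewrite ler_pM2l // lef_pV2 ?posrE; lra.
have main : e^-1 <= 'C(s, t)%:R * (w * v / (1 + w * v)) ^+ lam.+1.
  apply: (@le_trans _ _ ((D t)^-1 * n%:R ^+ t * (w * v / 2) ^+ lam.+1)).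
    rewrite (_ : w * v / 2 = (w / 2) * v); last by field.
    rewrite exprMn (_ : _ * _ = (D t)^-1 * (w / 2) ^+ lam.+1 * (v ^+ lam.+1 * n%:R ^+ t)); last by ring.
    (* The choice of [w] gives [w / 2 = D t / e + 1], which is at least 1, hence
       [D t / e <= w / 2 <= (w / 2) ^+ lam.+1]. *)
    rewrite vt mulr1 ler_pdivlMl // (le_trans (y := w / 2)) //; first by rewrite /w; lra.
    by rewrite exprS ler_peMr ?exprn_ege1; lra.
  apply: ler_pM.
  - by rewrite mulr_ge0 ?exprn_ge0 ?invr_ge0 // ltW.
  - by rewrite exprn_ge0 // divr_ge0 // ltW.
  - by rewrite ler_pdivrMl // binD.
  - by rewrite lerXn2r ?nnegrE // divr_ge0 //; lra.
have ie0 : 0 < e^-1 by rewrite invr_gt0.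
rewrite -[leRHS]invrK lef_pV2 ?posrE; lra.
Unshelve. all: by end_near.
Qed.
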